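(* Let $R$ be a stretched Artinian Gorenstein (commutative Noetherian) local ring whose embedding dimension satisfies $\operatorname{edim} R\ge 2$. Then $\operatorname{mod} R$ has a nontrivial extension-closed subcategory.
   Context: $\mathfrak m$ denotes the maximal ideal of $R$, $\ell(R)$ the length of $R$ as an $R$-module, and $\operatorname{edim} R$ the embedding dimension, i.e. the minimal number of generators of $\mathfrak m$. An Artinian local ring $R$ is stretched if $\mathfrak m^{\ell(R)-\operatorname{edim} R}\ne 0$. $\operatorname{mod} R$ is the category of finitely generated $R$-modules. A subcategory of $\operatorname{mod} R$ always means a nonempty full subcategory closed under isomorphism. A subcategory is extension-closed if it is closed under direct summands and closed under extensions (for every exact sequence $0\to L\to M\to N\to 0$ in $\operatorname{mod} R$ with $L,N$ in the subcategory, $M$ is also in it). The trivial extension-closed subcategories are: the one consisting of zero modules, the one consisting of all finitely generated free $R$-modules, and $\operatorname{mod} R$ itself; any other extension-closed subcategory is called nontrivial. *)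

(* Defs.v *)
From mathcomp Require Import all_boot all_order all_algebra.
From mathcomp Require Import boolp classical_sets.

Set Implicit Arguments.
Unset Strict Implicit.
Unset Printing Implicit Defensive.

Import GRing.Theory.
Local Open Scope classical_set_scope.
Local Open Scope ring_scope.

Section Modules.
Variable R : comNzRingType.
Implicit Types L M N X Y I C : lmodType R.

Definition submodule M (N : set M) : Prop := submod_closed (mem N).

Definition span M (S : set M) : set M := smallest (@submodule M) S.

Definition generated_by M (n : nat) (N : set M) : Prop :=
  exists g : 'I_n -> M, N = span (range g).

Definition finitely_generated M : Prop := exists n, generated_by n [set: M].

(* Length as a relation: [M] has a composition series with [l] factors. By
   Jordan-Hoelder there is at most one such [l], and there is one exactly when
   [M] has finite length. *)
Definition has_length M (l : nat) : Prop :=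
  exists N : nat -> set M,
    [/\ N 0%N = [set 0], N l = setT,
        forall i, (i <= l)%N -> submodule (N i)
      & forall i, (i < l)%N -> N i `<` N i.+1 /\
          forall K, submodule K -> N i `<=` K -> K `<=` N i.+1 ->
            K = N i \/ K = N i.+1].

Definition isomorphic M N : Prop := exists f : {linear M -> N}, bijective f.

Definition short_exact L M N (f : {linear L -> M}) (g : {linear M -> N}) :=
  [/\ injective f, range f = [set y | g y = 0] & range g = setT].

Definition is_zero M : Prop := forall x : M, x = 0.

Definition is_fg_free M : Prop := exists n, isomorphic 'rV[R]_n M.

Definition injective_module I : Prop :=
  forall M N (i : {linear M -> N}) (f : {linear M -> I}), injective i ->
    exists g : {linear N -> I}, forall x, g (i x) = f x.

(* [M] has an injective resolution 0 -> M -> I_0 -> ... -> I_n -> 0, broken up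
   into short exact sequences 0 -> M -> I_0 -> C -> 0, etc. *)
Fixpoint injdim_le (n : nat) M : Prop :=
  if n is n'.+1 then
    exists I C (f : {linear M -> I}) (g : {linear I -> C}),
      [/\ injective_module I, short_exact f g & injdim_le n' C]
  else injective_module M.

(* A predicate on all [R]-modules stands for the full subcategory of mod R
   whose objects are the modules satisfying it. *)
Record extension_closed (P : lmodType R -> Prop) : Prop := {
  ec_fg : forall M, P M -> finitely_generated M;
  ec_nonempty : exists M, P M;
  ec_iso : forall M N, isomorphic M N -> P M -> P N;
  ec_summand : forall X Y, P (X * Y)%type -> P X;
  ec_extension : forall L M N (f : {linear L -> M}) (g : {linear M -> N}),
    finitely_generated M -> short_exact f g -> P L -> P N -> P M }.

Definition trivial_subcategory (P : lmodType R -> Prop) : Prop :=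
  [\/ forall M, P M <-> is_zero M,
      forall M, P M <-> is_fg_free M
    | forall M, P M <-> finitely_generated M].

End Modules.

Section Rings.
Variable R : comNzRingType.

Definition ideal (I : set R) : Prop := @submodule R R^o I.

Definition ideal_mul (I J : set R) : set R :=
  @span R R^o [set x * y | x in I & y in J].

Definition ideal_pow (I : set R) (n : nat) : set R := iter n (ideal_mul I) setT.

Definition maximal_ideal (m : set R) : Prop :=
  [/\ ideal m, m <> setT
    & forall J, ideal J -> m `<=` J -> J = m \/ J = setT].

Definition noetherian : Prop :=
  forall I : set R, ideal I -> exists n, @generated_by R R^o n I.

Definition artinian : Prop :=
  forall I : nat -> set R, (forall i, ideal (I i)) ->
    (forall i, I i.+1 `<=` I i) ->
    exists n, forall i, (n <= i)%N -> I i = I n.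

Definition local_ring (m : set R) : Prop :=
  [/\ noetherian, maximal_ideal m & forall n, maximal_ideal n -> n = m].

Definition has_edim (m : set R) (e : nat) : Prop :=
  @generated_by R R^o e m /\
  forall n, @generated_by R R^o n m -> (e <= n)%N.

(* The truncated subtraction is harmless: in an Artinian local ring the length
   is strictly larger than the embedding dimension. *)
Definition stretched (m : set R) : Prop :=
  exists l e, [/\ @has_length R R^o l, has_edim m e
    & ideal_pow m (l - e) <> [set 0]].

(* For a Noetherian local ring. *)
Definition gorenstein : Prop := exists n, @injdim_le R n R^o.

End Rings.

Arguments noetherian R : clear implicits.
Arguments artinian R : clear implicits.
Arguments gorenstein R : clear implicits.

(* Main.v *)
From HB Require Import structures.
From mathcomp Require Import all_boot all_algebra classical_sets boolp zify.
Require Import Defs.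

(** Write [m^n] for the powers of the maximal ideal. Since [R] is stretched,
    counting lengths shows that no ideal lies strictly between [m^(i+1)] and
    [m^i] for [i >= 2]. Hence [m^2 = zR], and multiplication by [z] maps [m/m^2],
    of dimension at least 2, to [m^3/m^4], of dimension at most 1. Correcting an
    element of the kernel by an element of [m^2] gives [y] in [m] outside [m^2]
    with [m^2 y = 0]. A finite injective resolution of [R] forces the socle of
    [R] to be simple, so [y] is not in the socle. As a group is not the union of
    two proper subgroups, some [b] in [m] lies neither in the annihilator of [y]
    nor in [yR]. The modules [M] with [Ext^1(R/yR, M) = 0] form an extension-closed
    subcategory. It contains [bR], which is nonzero and not free, because
    [yR `&` bR] is the socle [byR], but it does not contain the socle itself. *)

Set Implicit Arguments.
Unset Strict Implicit.
Unset Printing Implicit Defensive.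

Import GRing.Theory.
Local Open Scope classical_set_scope.
Local Open Scope ring_scope.

(** * Submodules and length *)

Section Submodules.
Variables (R : comNzRingType) (M : lmodType R).
Implicit Types (S K : set M).

Lemma submoduleP S :
  submodule S <-> S 0 /\ forall a x y, S x -> S y -> S (a *: x + y).
Proof.
split=> [[S0 SL]|[S0 SL]].
  by split=> [|a x y Sx Sy]; [have := S0|have := SL a x y]; rewrite !in_setE; auto.
split=> [|a x y]; rewrite !in_setE //; exact: SL.
Qed.

Lemma submodule0 S : submodule S -> S 0.
Proof. by case/submoduleP. Qed.

Lemma submoduleD S x y : submodule S -> S x -> S y -> S (x + y).
Proof. by case/submoduleP=> _ SL Sx Sy; rewrite -[x]scale1r; apply: SL. Qed.

Lemma submoduleZ S a x : submodule S -> S x -> S (a *: x).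
Proof. by case/submoduleP=> S0 SL Sx; rewrite -[_ *: _]addr0; apply: SL. Qed.

Lemma submoduleB S x y : submodule S -> S x -> S y -> S (x - y).
Proof.
move=> subS Sx Sy; rewrite -scaleN1r.
by apply: submoduleD => //; apply: submoduleZ.
Qed.

Lemma submoduleI S K : submodule S -> submodule K -> submodule (S `&` K).
Proof.
move=> /submoduleP[S0 SL] /submoduleP[K0 KL]; apply/submoduleP.
by split=> [|a x y [Sx Kx] [Sy Ky]]; split; auto.
Qed.

Lemma submodule_set0 : submodule [set (0 : M)].
Proof. by apply/submoduleP; split=> [|a x y -> ->]//=; rewrite scaler0 addr0. Qed.

Lemma submodule_setT : submodule [set: M].
Proof. exact/submoduleP. Qed.

Definition submodule_sum S K : set M := [set x | exists2 y, S y & K (x - y)].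

Lemma submodule_sumP S K : submodule S -> submodule K ->
  submodule (submodule_sum S K).
Proof.
move=> /submoduleP[S0 SL] /submoduleP[K0 KL]; apply/submoduleP.
split=> [|a x y [x' Sx Kx] [y' Sy Ky]]; first by exists 0; rewrite // subr0.
exists (a *: x' + y'); first exact: SL.
have -> : a *: x + y - (a *: x' + y') = a *: (x - x') + (y - y').
  by rewrite scalerBr opprD addrACA.
exact: KL.
Qed.

Lemma sub_suml S K : submodule K -> S `<=` submodule_sum S K.
Proof. by move=> subK x Sx; exists x; rewrite // subrr; apply: submodule0. Qed.

Lemma sub_sumr S K : submodule S -> K `<=` submodule_sum S K.
Proof. by move=> subS x Kx; exists 0; rewrite ?subr0 //; apply: submodule0. Qed.

Lemma sum_sub S K T : submodule T -> S `<=` T -> K `<=` T ->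
  submodule_sum S K `<=` T.
Proof.
move=> subT ST KT x [y Sy Kxy]; rewrite -(subrK y x).
by apply: submoduleD => //; [apply: KT|apply: ST].
Qed.

Definition cyclic (b : M) : set M := range (fun r : R => r *: b).

Lemma submodule_cyclic b : submodule (cyclic b).
Proof.
apply/submoduleP; split=> [|a _ _ [r _ <-] [s _ <-]].
  by exists 0; rewrite ?scale0r.
by exists (a * r + s); rewrite // scalerDl scalerA.
Qed.

Lemma mem_cyclic b : cyclic b b.
Proof. by exists 1; rewrite ?scale1r. Qed.

Lemma cyclic_sub b S : submodule S -> S b -> cyclic b `<=` S.
Proof. by move=> subS Sb _ [r _ <-]; apply: submoduleZ. Qed.

Lemma submodule_span S : submodule (span S).
Proof.
apply/submoduleP; split=> [|a x y Sx Sy] A [subA SA]; first exact: submodule0.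
by apply: submoduleD => //; [apply: submoduleZ => //; apply: Sx|apply: Sy].
Qed.

Lemma sub_span S : S `<=` span S.
Proof. by move=> x Sx A [_]; apply. Qed.

Lemma span_sub S K : submodule K -> S `<=` K -> span S `<=` K.
Proof. by move=> subK SK x; apply. Qed.

Lemma spanS S K : S `<=` K -> span S `<=` span K.
Proof.
by move=> SK; apply: span_sub (submodule_span _) _ => x /SK; apply: sub_span.
Qed.

Lemma generated_by_seq (s : seq M) :
  generated_by (size s) (span [set x | x \in s]).
Proof.
exists (fun i => nth 0 s i); congr span; apply/seteqP; split=> x /=.
  by move/(nthP 0) => [i lt_i <-]; exists (Ordinal lt_i).
by move=> [i _ <-]; apply: mem_nth.
Qed.

(* The rank of [K] is the number of indices [i] at which [K `&` N i] grows,
   for a fixed composition series [N]. *)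
Lemma length_rank l : has_length M l -> exists rk : set M -> nat,
  [/\ forall K K', submodule K -> submodule K' -> K `<` K' -> (rk K < rk K')%N
    & forall K, (rk K <= l)%N].
Proof.
case=> N [N0 Nl subN Nstep].
pose jump K := [set i : 'I_l | ~~ `[< K `&` N i.+1 `<=` N i >]]%SET.
exists (fun K => #|jump K|); split=> [K K' subK subK' ltK|K]; last first.
  by rewrite -[X in (_ <= X)%N](card_ord l) max_card.
have [leK neK] : K `<=` K' /\ ~ K' `<=` K by case: ltK.
apply: proper_card; rewrite properE; apply/andP; split.
  apply/fintype.subsetP => i; rewrite !inE; apply: contra => /asboolP h.
  by apply/asboolP => x [/leK Kx Nx]; apply: h.
apply/negP => /fintype.subsetP sub_jump; apply: neK => x.
suff : forall i, (i <= l)%N -> K' `&` N i `<=` K.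
  by move=> /(_ l (leqnn l)) h K'x; apply: h; rewrite Nl.
move=> {x}; elim=> [_ x [_]|i IH lt_il x [K'x Nx]].
  by rewrite N0 => ->; apply: submodule0.
pose io := Ordinal lt_il.
have [jK|] := boolP (io \in jump K); last first.
  move/(contra (sub_jump io)); rewrite inE negbK => /asboolP h.
  by apply: IH (ltnW lt_il) _ _; split=> //; apply: h.
have subNi := subN i (ltnW lt_il); have subNi1 := subN i.+1 lt_il.
have [[leN _] simpN] := Nstep i lt_il.
have sub_sum := submodule_sumP (submoduleI subK subNi1) subNi.
(* At a jump of [K], [N i.+1] is the sum of [K] intersected with it and [N i]; subtracting the
   component in [K] leaves an element of [K'] in [N i]. *)
case: (simpN _ sub_sum).
- by apply: sub_sumr; apply: submoduleI.
- by apply: sum_sub => // y [].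
- move=> eqN; move: jK; rewrite inE => /asboolP; case=> y Ky.
  by rewrite /= -eqN; apply: sub_suml.
move=> eqN; move: Nx; rewrite -eqN => -[y [Ky Ny] Nxy].
rewrite -(subrK y x); apply: submoduleD => //.
by apply: IH (ltnW lt_il) _ _; split=> //; apply: submoduleB => //; apply: leK.
Qed.

End Submodules.

(** * Submodules as modules *)

Section SubmoduleType.
Variables (R : comNzRingType) (M : lmodType R) (S : set M).
Hypothesis subS : submodule S.

(* The proof of closure is a parameter of the type so that its module structure
   can be inferred. *)
Definition submodule_pred of submodule S : {pred M} := mem S.

HB.instance Definition _ :=
  GRing.isSubmodClosed.Build R M (submodule_pred subS)
    (GRing.submod_closed_semi subS).

Definition submodule_type := {x : M | x \in submodule_pred subS}.

HB.instance Definition _ := SubType.on submodule_type.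
HB.instance Definition _ := Choice.on submodule_type.
HB.instance Definition _ := [SubChoice_isSubLmodule of submodule_type by <:].

Definition insub_submodule (x : M) (Sx : S x) : submodule_type :=
  Sub x (mem_set Sx).

Lemma submodule_typeP (x : submodule_type) : S (val x).
Proof. by case: x => x /= /set_mem. Qed.

End SubmoduleType.

(** * Vanishing of Ext *)

Section FinitelyGenerated.
Variable R : comNzRingType.

Lemma finitely_generated_image (M N : lmodType R) (f : {linear M -> N}) :
  range f = setT -> finitely_generated M -> finitely_generated N.
Proof.
move=> fT [n [g gT]]; exists n; exists (f \o g); apply/seteqP; split=> // y _.
have [x _ <-] : range f y by rewrite fT.
have subK : submodule (f @^-1` span (range (f \o g))).
  have /submoduleP[S0 SL] := submodule_span (range (f \o g)).
  apply/submoduleP; split=> [|a u v Su Sv] /=; first by rewrite linear0.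
  by rewrite linearP; apply: SL.
suff : span (range g) `<=` f @^-1` span (range (f \o g)).
  by apply; rewrite -gT.
by apply: span_sub => // _ [i _ <-]; apply: sub_span; exists i.
Qed.

Lemma finitely_generated_cyclic (M : lmodType R) (b : M) :
  finitely_generated (submodule_type (submodule_cyclic b)).
Proof.
exists 1%N; exists (fun=> insub_submodule (submodule_cyclic b) (mem_cyclic b)).
apply/seteqP; split=> // x _.
have [r _ def_x] := submodule_typeP x.
have -> : x = r *: insub_submodule (submodule_cyclic b) (mem_cyclic b).
  by apply/val_inj; rewrite -def_x.
by apply: submoduleZ (submodule_span _) _; apply: sub_span; exists ord0.
Qed.

End FinitelyGenerated.

Section ExtVanishing.
Variables (R : comNzRingType) (y : R).

(* [Ext^1(R/yR, M) = 0], computed from a resolution of [R/yR] that starts with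
   multiplication by [y] on [R]. *)
Definition Ext1_vanishes (M : lmodType R) : Prop :=
  forall w : M, (forall a : R, a * y = 0 -> a *: w = 0) ->
    exists v, w = y *: v.

Definition fg_Ext1_vanishes (M : lmodType R) : Prop :=
  finitely_generated M /\ Ext1_vanishes M.

Lemma Ext1_vanishes_iso (M N : lmodType R) :
  isomorphic M N -> Ext1_vanishes M -> Ext1_vanishes N.
Proof.
move=> [f bij_f] extM w kill_w; have [g fK gK] := bij_f.
have [a /kill_w aw0|v def_w] := extM (g w).
  by apply: (can_inj fK); rewrite linearZ /= gK aw0 linear0.
by exists (f v); rewrite -linearZ -def_w gK.
Qed.

Lemma Ext1_vanishes_summand (X Y : lmodType R) :
  Ext1_vanishes (X * Y)%type -> Ext1_vanishes X.
Proof.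
move=> extXY w kill_w; have [a ay0|[v u] [-> _]] := extXY (w, 0).
  by congr pair; [apply: kill_w|rewrite scaler0].
by exists v.
Qed.

(** Middle exactness of [Ext^1(R/yR, -)] by hand: once [y] times a lift of the solution in [N] is
    subtracted, the remainder comes from [L]. *)
Lemma Ext1_vanishes_extension (L M N : lmodType R)
    (f : {linear L -> M}) (g : {linear M -> N}) :
  short_exact f g -> Ext1_vanishes L -> Ext1_vanishes N -> Ext1_vanishes M.
Proof.
move=> [inj_f ker_g im_g] extL extN w kill_w.
have [a /kill_w aw0|n def_n] := extN (g w).
  by rewrite -linearZ /= aw0 linear0.
have [v _ def_v] : range g n by rewrite im_g.
have [u _ def_u] : range f (w - y *: v).
  by rewrite ker_g /= linearB linearZ def_v def_n subrr.
have [a ay0|t def_t] := extL u.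
  apply: inj_f; rewrite linearZ /= def_u linear0 scalerBr kill_w // scalerA ay0.
  by rewrite scale0r subrr.
exists (f t + v).
by rewrite scalerDr -linearZ -def_t def_u subrK.
Qed.

Lemma extension_closed_fg_Ext1_vanishes (M0 : lmodType R) :
  fg_Ext1_vanishes M0 -> extension_closed fg_Ext1_vanishes.
Proof.
move=> PM0; split=> [M []//|||X Y [fgXY extXY]|L M N f g fgM fg_exact PL PN].
- by exists M0.
- move=> M N isoMN [fgM extM]; split; last exact: Ext1_vanishes_iso extM.
  case: isoMN => f bij_f; apply: (@finitely_generated_image _ _ _ f _ fgM).
  by apply/seteqP; split=> // x _; have [h _ hK] := bij_f; exists (h x).
- split; last exact: Ext1_vanishes_summand extXY.
  apply: (@finitely_generated_image _ _ _ fst _ fgXY).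
  by apply/seteqP; split=> // x _; exists (x, 0).
split=> //; exact: Ext1_vanishes_extension fg_exact PL.2 PN.2.
Qed.

End ExtVanishing.

(** * Local rings of finite length *)

Section InjectiveModules.
Variables (R : comNzRingType) (m : set R).

(* The case of Baer's criterion needed to extend maps along
   [J <= J + aR], whose quotient is simple. *)
Lemma injective_extend (I : lmodType R) (J : set R) (a : R) (t : I) :
  injective_module I -> ideal J -> (forall x, m x \/ exists z, z * x = 1) ->
  ~ J a -> (forall x, m x -> J (x * a)) -> (forall x, m x -> x *: t = 0) ->
  exists u : I, (forall j, J j -> j *: u = 0) /\ a *: u = t.
Proof.
move=> injI idJ local_m nJa mJa mt0.
(* The map to extend sends [r a + j] to [r t]. If [r a] lies in [J], then [r] is no unit, as [a] is
   outside [J], so [r] kills [t]. *)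
have well_def r : J (r * a) -> r *: t = 0.
  move=> Jra; have [/mt0 //|[z zr1]] := local_m r; case: nJa.
  by rewrite -[a]mul1r -zr1 -mulrA; exact: (submoduleZ z idJ Jra).
pose J' := submodule_sum (cyclic (a : R^o)) J.
have idJ' : submodule J' by apply: submodule_sumP => //; apply: submodule_cyclic.
have coefP (x : submodule_type idJ') : exists r, J (val x - r * a).
  by have [_ [r _ <-] Jx] := submodule_typeP x; exists r.
pose coef x := projT1 (cid (coefP x)).
pose f x := coef x *: t.
have fE x r : J (val x - r * a) -> f x = r *: t.
  move=> Jx; apply/eqP; rewrite -subr_eq0 -scalerBl; apply/eqP/well_def.
  have := submoduleB idJ Jx (projT2 (cid (coefP x))).
  by rewrite opprB addrC addrA subrK mulrBl.
have lin_f : linear f.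
  move=> c x z; rewrite (fE _ (c * coef x + coef z)).
    by rewrite /f scalerDl scalerA.
  have -> : val (c *: x + z) - (c * coef x + coef z) * a
      = c *: (val x - coef x * a) + (val z - coef z * a).
    rewrite linearP /= scalerBr mulrDl opprD addrACA; congr (_ - _ + _).
    by rewrite -mulrA.
  apply: submoduleD => //; last exact: projT2 (cid (coefP z)).
  by apply: submoduleZ => //; exact: projT2 (cid (coefP x)).
pose F : {linear submodule_type idJ' -> I} :=
  HB.pack f (GRing.isLinear.Build _ _ _ _ f lin_f).
(* On [R] the extension is determined by [g 1], which is the required [u]. *)
have [g gF] := injI (submodule_type idJ') R^o (val : {linear _ -> _}) F val_inj.
have gE x : J' x -> exists h : submodule_type idJ', val h = x /\ f h = x *: g 1.
  move=> J'x; exists (insub_submodule idJ' J'x); split=> //.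
  by rewrite -linearZ -[f _]/(F _) -gF /= -[_ *: _]/(x * 1) mulr1.
exists (g 1); split=> [j Jj|].
  have [h [h_j <-]] := gE j (sub_sumr (submodule_cyclic _) Jj).
  by rewrite (fE _ 0) ?scale0r // mul0r subr0 h_j.
have [h [h_a <-]] := gE a (sub_suml idJ (mem_cyclic _)).
rewrite (fE _ 1) ?scale1r // mul1r h_a subrr; exact: (submodule0 idJ).
Qed.

End InjectiveModules.

(** * Powers of an ideal and Nakayama's lemma *)

Section IdealPowers.
Variables (R : comNzRingType) (I : set R).
Hypothesis idI : ideal I.

Lemma idealMl (J : set R) a x : ideal J -> J x -> J (a * x).
Proof. exact: (@submoduleZ R R^o). Qed.

Lemma ideal_ideal_pow n : ideal (ideal_pow I n).
Proof.
case: n => [|n]; first exact: (@submodule_setT R R^o).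
exact: (@submodule_span R R^o).
Qed.

Lemma ideal_pow_mul n a x : I a -> ideal_pow I n x -> ideal_pow I n.+1 (a * x).
Proof. by move=> Ia Ix; apply: sub_span; exists a => //; exists x. Qed.

Lemma ideal_powS_sub n (J : set R) : ideal J ->
  (forall a x, I a -> ideal_pow I n x -> J (a * x)) -> ideal_pow I n.+1 `<=` J.
Proof.
by move=> idJ h; apply: (@span_sub R R^o) => // _ [a Ia [x Ix <-]]; apply: h.
Qed.

Lemma ideal_pow_antitone i j :
  (i <= j)%N -> ideal_pow I j `<=` ideal_pow I i.
Proof.
move=> /subnK <-; elim: (j - i)%N => [//|k IH].
apply: ideal_powS_sub (ideal_ideal_pow i) _ => a x _ /IH.
exact: idealMl (ideal_ideal_pow i).
Qed.

Lemma ideal_pow1 : ideal_pow I 1 = I.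
Proof.
apply/seteqP; split=> [|x Ix].
  by apply: ideal_powS_sub => // a x Ia _; rewrite mulrC; apply: idealMl.
by rewrite -[x]mulr1; apply: ideal_pow_mul.
Qed.

(** Iterating the hypothesis puts [I^i] inside [A + I^(k+i)] for every [k], and the power vanishes
    at [k = n]. *)
Lemma nilpotent_nakayama (A : set R) n i :
  ideal_pow I n `<=` [set 0] -> ideal A ->
  ideal_pow I i `<=` @submodule_sum R R^o A (ideal_pow I i.+1) ->
  ideal_pow I i `<=` A.
Proof.
move=> nilI idA sub_i.
have sub_k k : ideal_pow I (k + i) `<=`
    @submodule_sum R R^o A (ideal_pow I (k + i).+1).
  elim: k => [//|k IH]; apply: ideal_powS_sub.
    by apply: (@submodule_sumP R R^o) => //; apply: ideal_ideal_pow.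
  move=> a x Ia /IH [y Ay Ixy]; exists (a * y); first exact: idealMl.
  by rewrite -mulrBr; apply: ideal_pow_mul.
have sub_ik k : ideal_pow I i `<=` @submodule_sum R R^o A (ideal_pow I (k + i)).
  elim: k => [|k IH].
    exact: (@sub_sumr R R^o).
  move=> x /IH; apply: (@sum_sub R R^o).
  - by apply: (@submodule_sumP R R^o) => //; apply: ideal_ideal_pow.
  - by apply: (@sub_suml R R^o) => //; apply: ideal_ideal_pow.
  - exact: sub_k.
move=> x /(sub_ik n) [y Ay /(ideal_pow_antitone (leq_addr i n)) /nilI /= /eqP].
by rewrite subr_eq0 => /eqP ->.
Qed.

End IdealPowers.

Section LocalFiniteLength.
Variables (R : comNzRingType) (m : set R) (l : nat).
Hypotheses (local_m : local_ring m) (lenR : @has_length R R^o l).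

Let max_m : maximal_ideal m. Proof. by have [_ + _] := local_m. Qed.
Let id_m : ideal m. Proof. by have [] := max_m. Qed.

(** Induction on [l - rk J] replaces Zorn's lemma: either a larger proper ideal exists, or [J] is
    maximal and equals [m] by uniqueness. *)
Lemma proper_sub_maximal (J : set R) : ideal J -> J <> setT -> J `<=` m.
Proof.
have [rk [rk_lt rk_le]] := length_rank lenR.
have [n] := ubnP (l - rk J)%N; elim: n J => // n IH J le_n idJ nJ.
have [[K idK [JK nJK nK]]|maxJ] :=
    pselect (exists2 K, ideal K & [/\ J `<=` K, K <> J & K <> setT]).
  apply: (subset_trans JK); apply: IH => //.
  have /rk_lt : J `<` K.
    by split=> // KJ; apply: nJK; apply/seteqP.
  move=> /(_ idJ idK) lt_rk; have := rk_le K.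
  move: le_n lt_rk; rewrite ltnS => le_n lt_rk le_l.
  by apply: leq_trans le_n; rewrite ltn_sub2l // (leq_trans lt_rk).
case: local_m => _ _ uniq_m; rewrite -(uniq_m J) //; split=> // K idK JK.
have [KJ|nKJ] := pselect (K = J); first by left.
right; apply: contrapT => nK; apply: maxJ; exists K => //; split=> //.
Qed.

Lemma local_unit (x : R) : m x \/ exists z, z * x = 1.
Proof.
have [xT|nxT] := pselect (@cyclic R R^o x = setT); [right|left].
  by have [z _ zx] : @cyclic R R^o x 1; [rewrite xT|exists z].
apply: (proper_sub_maximal _ nxT); last exact: (@mem_cyclic R R^o).
exact: (@submodule_cyclic R R^o).
Qed.

Lemma maximal_not1 : ~ m 1.
Proof.
case: max_m => _ nmT _ m1; apply: nmT; apply/seteqP; split=> // x _.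
by rewrite -[x]mulr1; apply: idealMl.
Qed.

Lemma maximal_mul_fixed a x : m a -> a * x = x -> x = 0.
Proof.
move=> ma axx; have [m1a|[z z1a]] := local_unit (1 - a).
  case: maximal_not1; rewrite -(subrK a 1).
  exact: (@submoduleD R R^o).
by rewrite -[x]mul1r -z1a -mulrA mulrBl mul1r axx subrr mulr0.
Qed.

(** For [z] nonzero, multiplication by an element of [m] strictly lowers the rank of [zR], so [m^n]
    kills [z] once that rank is at most [n]. Then take [z = 1]. *)
Lemma maximal_nilpotent : ideal_pow m l `<=` [set 0].
Proof.
have [rk [rk_lt rk_le]] := length_rank lenR.
suff kill n a z : ideal_pow m n a -> (rk (@cyclic R R^o z) <= n)%N -> a * z = 0.
  by move=> a ma; rewrite /= -[a]mulr1; apply: (kill l).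
elim: n a z => [a z _|n IH a z].
  have [-> _|/eqP z0] := eqVneq z 0; first by rewrite mulr0.
  suff /rk_lt : [set 0] `<` @cyclic R R^o z.
    move=> /(_ (@submodule_set0 _ _) (@submodule_cyclic _ _ _)) lt_rk.
    by move=> /(leq_trans lt_rk).
  split=> [_ ->|/(_ _ (@mem_cyclic R R^o z))] //.
  exact: (submodule0 (@submodule_cyclic R R^o z)).
move=> pow_a le_rk; move: a pow_a.
suff : ideal_pow m n.+1 `<=` [set a | a * z = 0] by [].
apply: ideal_powS_sub => [|a x ma pow_x /=].
  apply/(@submoduleP R R^o); split=> [|a x y /= xz yz]; first by rewrite /= mul0r.
  by rewrite mulrDl -[_ *: _]/(a * x) -mulrA xz yz mulr0 addr0.
have [az0|/eqP az0] := eqVneq (a * z) 0; first by rewrite mulrAC az0 mul0r.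
rewrite mulrAC mulrC; apply: IH => //; rewrite -ltnS.
apply: leq_trans le_rk; apply: rk_lt; try exact: submodule_cyclic.
split=> [|sub_az].
  apply: (@cyclic_sub R R^o); first exact: submodule_cyclic.
  by exists a.
have [c _ def_z] := sub_az z (mem_cyclic _).
case: az0; rewrite (@maximal_mul_fixed (a * c) z) ?mulr0 //.
  by rewrite mulrC; apply: idealMl.
by rewrite -[RHS]def_z -[_ *: _]/(c * (a * z)) mulrA [c * a]mulrC.
Qed.

(** For the least [n] with [m^n] inside [J], any element of [m^(n-1)] outside [J] works. *)
Lemma exists_simple_extension (J : set R) : ideal J -> J <> setT ->
  exists2 a, ~ J a & forall x, m x -> J (x * a).
Proof.
move=> idJ nJT.
have exn : exists n, `[< ideal_pow m n `<=` J >].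
  exists l; apply/asboolP => x /maximal_nilpotent ->.
  exact: (submodule0 (idJ : @submodule R R^o J)).
case: (ex_minnP exn) => -[|n] /asboolP powJ min_n.
  by case: nJT; apply/seteqP.
have [a [pow_a nJa]] : exists a, ideal_pow m n a /\ ~ J a.
  apply: contrapT => /forallNP h; suff /min_n : `[< ideal_pow m n `<=` J >] by rewrite ltnn.
  apply/asboolP => a pow_a; apply: contrapT => nJa; exact: (h a).
by exists a => // x mx; apply: powJ; apply: ideal_pow_mul.
Qed.

(** * The socle under finite injective dimension *)

Section Socle.
Variable rho : R.
Hypotheses (rho0 : rho <> 0) (m_rho : forall x, m x -> x * rho = 0).

(* For [rho] a nonzero socle element of [R] this says that the socle of [C] is
   contained in [rho C]. *)
Definition socle_divisible (C : lmodType R) : Prop :=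
  forall v : C, (forall x, m x -> x *: v = 0) -> exists u, v = rho *: u.

Lemma injective_socle_divisible (I : lmodType R) :
  injective_module I -> socle_divisible I.
Proof.
move=> injI v mv.
have [] := @injective_extend R m I [set 0] rho v injI _ local_unit _ _ mv.
- exact: (@submodule_set0 R R^o).
- by move=> /rho0.
- by move=> x /m_rho.
by move=> u [_ <-]; exists u.
Qed.

Section ShortExact.
Variables (C I C' : lmodType R) (f : {linear C -> I}) (g : {linear I -> C'}).
Hypotheses (injI : injective_module I) (fg_exact : short_exact f g).
Hypothesis divC' : socle_divisible C'.

(* This is [Ext^1(R/J, C) = 0]: the filtration of [R/J] by copies of the residue
   field reduces it to [J = m], where divisibility of the socle of [C'] applies. *)
Lemma lift_annihilated (J : set R) (w : C') : ideal J ->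
  (forall j, J j -> j *: w = 0) ->
  exists2 u, g u = w & forall j, J j -> j *: u = 0.
Proof.
have [inj_f ker_g im_g] := fg_exact.
have [rk [rk_lt rk_le]] := length_rank lenR.
have [n] := ubnP (l - rk J)%N; elim: n J w => // n IH J w le_n idJ Jw.
have [JT|nJT] := pselect (J = setT).
  exists 0; first by rewrite linear0 -[w]scale1r Jw // JT.
  by move=> j _; rewrite scaler0.
have [a nJa mJa] := exists_simple_extension idJ nJT.
have [v def_v] : exists v, a *: w = rho *: v.
  by apply: divC' => x mx; rewrite scalerA Jw //; apply: mJa.
have [v1 _ gv1] : range g v by rewrite im_g.
(* This [u] is chosen so that [w - g u] is killed by [a] as well as by [J]; induction then applies
   to [J + aR]. *)
have [u [Ju au]] : exists u : I,
    (forall j, J j -> j *: u = 0) /\ a *: u = rho *: v1.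
  apply: injective_extend local_unit nJa mJa _ => // x mx.
  by rewrite scalerA m_rho // scale0r.
pose J' := @submodule_sum R R^o J (@cyclic R R^o a).
have idJ' : ideal J'.
  by apply: submodule_sumP => //; apply: submodule_cyclic.
have [||u' gu' J'u'] := IH J' (w - g u) _ idJ'.
- have /rk_lt : J `<` J'.
    split; first exact: (sub_suml (@submodule_cyclic R R^o a)).
    by move=> /(_ a (sub_sumr idJ (mem_cyclic _))).
  move=> /(_ idJ idJ') lt_rk; have := rk_le J'.
  move: le_n lt_rk; rewrite ltnS => le_n lt_rk le_l.
  by apply: leq_trans le_n; rewrite ltn_sub2l // (leq_trans lt_rk).
- move=> x [j Jj [r _ ra]].
  have aw_u : a *: (w - g u) = 0.
    by rewrite scalerBr def_v -linearZ /= au linearZ /= gv1 subrr.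
  have jw_u : j *: (w - g u) = 0.
    by rewrite scalerBr Jw // -linearZ /= Ju // linear0 subrr.
  rewrite -[x](subrK j) -ra scalerDl jw_u addr0 -[_ *: (a : R^o)]/(r * a).
  by rewrite -scalerA aw_u scaler0.
exists (u' + u); first by rewrite linearD gu' subrK.
move=> j Jj; rewrite scalerDr Ju // addr0; apply: J'u'.
exact: (sub_suml (@submodule_cyclic R R^o a)).
Qed.

(** Write [f v = rho u]. Then [rho] kills [g u], which lifts to some [u'] killed by [rho]; the
    preimage of [u - u'] in [C] times [rho] is [v]. *)
Lemma socle_divisible_exact : socle_divisible C.
Proof.
have [inj_f ker_g im_g] := fg_exact => v mv.
have [|u def_u] := injective_socle_divisible injI (v := f v).
  by move=> x mx; rewrite -linearZ /= mv // linear0.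
have [|j [r _ <-]|u' gu' ru'] := @lift_annihilated (@cyclic R R^o rho) (g u).
- exact: (@submodule_cyclic R R^o).
- have gfv : g (rho *: u) = 0.
    by rewrite -def_u; have : range f (f v) by []; rewrite ker_g.
  by rewrite -[r *: (rho : R^o)]/(r * rho) -scalerA -[rho *: g u]linearZ gfv scaler0.
have [t _ ft] : range f (u - u').
  by rewrite ker_g /= linearB gu' subrr.
exists t; apply: inj_f; rewrite linearZ /= ft scalerBr -def_u ru' ?subr0 //.
exact: (@mem_cyclic R R^o).
Qed.

End ShortExact.

Lemma injdim_socle_divisible n (C : lmodType R) :
  injdim_le n C -> socle_divisible C.
Proof.
elim: n C => [|n IH] C /=; first exact: injective_socle_divisible.
case=> I [C' [f [g [injI fg_exact /IH divC']]]].
exact: socle_divisible_exact injI fg_exact divC'.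
Qed.

(** As [rho] may be any nonzero socle element, this makes the socle of [R] simple. *)
Lemma gorenstein_socle (v : R) : gorenstein R ->
  (forall x, m x -> x * v = 0) -> exists u, v = u * rho.
Proof.
case=> n /injdim_socle_divisible divR mv.
by have [u ->] := divR v mv; exists u; rewrite mulrC.
Qed.

End Socle.

End LocalFiniteLength.

(** * Stretched rings *)

Section Stretched.
Variables (R : comNzRingType) (m : set R) (l e : nat).
Hypotheses (local_m : local_ring m) (lenR : @has_length R R^o l).
Hypotheses (edim_m : has_edim m e) (e_ge2 : (2 <= e)%N).
Hypothesis stretched_m : ideal_pow m (l - e) <> [set 0].

Let id_m : ideal m. Proof. by have [_ [+ _ _] _] := local_m. Qed.

Local Notation pow := (ideal_pow m).
Local Notation sum := (@submodule_sum R R^o : set R -> set R -> set R).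
Local Notation gen := (@cyclic R R^o : R -> set R).

Let id_pow n : ideal (pow n) := @ideal_ideal_pow R m n.
Let id_gen a : ideal (gen a) := @submodule_cyclic R R^o a.

Let id_sum (I J : set R) : ideal I -> ideal J -> ideal (sum I J).
Proof. exact: (@submodule_sumP R R^o). Qed.

Let pow_sub i j : (i <= j)%N -> pow j `<=` pow i.
Proof. exact: ideal_pow_antitone. Qed.

Let nakayama i (A : set R) : ideal A -> pow i `<=` sum A (pow i.+1) -> pow i `<=` A.
Proof. exact: (nilpotent_nakayama (maximal_nilpotent local_m lenR)). Qed.

Lemma ideal_powS_neq0 n : pow n <> [set 0] -> pow n.+1 `<` pow n.
Proof.
move=> pow0; split; first exact: pow_sub.
move=> sub_n; apply: pow0; apply/seteqP; split; last first.
  by move=> _ ->; exact: (submodule0 (id_pow n)).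
apply: nakayama; first exact: (@submodule_set0 R R^o).
apply: (subset_trans sub_n).
by apply: (@sub_sumr R R^o); exact: (@submodule_set0 R R^o).
Qed.

(** By Nakayama, elements of [m] generating it modulo [m^2] already generate it. *)
Lemma generating_seq_size (s : seq R) : (forall x, x \in s -> m x) ->
  m `<=` sum (@span R R^o [set x | x \in s]) (pow 2) -> (e <= size s)%N.
Proof.
move=> sm; rewrite -{1}(ideal_pow1 id_m) => /nakayama.
rewrite (ideal_pow1 id_m) => /(_ (@submodule_span R R^o _)) m_sub.
case: edim_m => _; apply.
have -> : m = @span R R^o [set x | x \in s]; last exact: (@generated_by_seq R R^o).
by apply/seteqP; split=> //; apply: (@span_sub R R^o).
Qed.

(** * Counting lengths along the powers of the maximal ideal *)

Section Rank.
Variable rk : set R -> nat.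
Hypothesis rk_lt :
  forall I J : set R, ideal I -> ideal J -> I `<` J -> (rk I < rk J)%N.
Hypothesis rk_le : forall I, (rk I <= l)%N.

(** Adjoin elements of [m] to [m^2] one at a time: fewer than [e] of them cannot generate [m] modulo
    [m^2], so [e] successive enlargements can be strict. *)
Lemma rank_square : (rk (pow 2) + e <= rk m)%N.
Proof.
have rk_mono I J : ideal I -> ideal J -> I `<=` J -> (rk I <= rk J)%N.
  move=> idI idJ IJ; have [JI|nJI] := pselect (J `<=` I).
    by have -> : I = J by apply/seteqP.
  by apply/ltnW/rk_lt.
pose A (s : seq R) : set R := sum (@span R R^o [set x | x \in s]) (pow 2).
have idA s : ideal (A s) by apply: id_sum => //; exact: (@submodule_span R R^o).
have A_m s : (forall x, x \in s -> m x) -> A s `<=` m.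
  move=> sm; apply: (@sum_sub R R^o) => //; first exact: (@span_sub R R^o).
  by rewrite -[X in _ `<=` X](ideal_pow1 id_m); apply: pow_sub.
suff [s [size_s sm] rk_s] : exists2 s : seq R,
    size s = e /\ (forall x, x \in s -> m x) & (rk (pow 2) + e <= rk (A s))%N.
  exact: leq_trans rk_s (rk_mono _ _ (idA s) id_m (A_m s sm)).
elim: {-2}e (leqnn e) => [_|k IH lt_ke].
  exists [::] => //; rewrite addn0; apply: rk_mono => //.
  by apply: (@sub_sumr R R^o); exact: (@submodule_span R R^o).
have [s [size_s sm] rk_s] := IH (ltnW lt_ke).
have [x [mx nAx]] : exists x, m x /\ ~ A s x.
  apply: contrapT => /forallNP h; have : (e <= size s)%N.
    apply: generating_seq_size => // x mx.
    by apply: contrapT => nAx; exact: (h x).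
  by rewrite size_s leqNgt lt_ke.
exists (x :: s); first split; rewrite /= ?size_s //.
  by move=> z; rewrite inE => /predU1P[->|/sm].
rewrite addnS; apply: leq_ltn_trans rk_s _; apply: rk_lt => //; split.
  apply: (@sum_sub R R^o _ _ _ (idA (x :: s))) => //.
    apply: subset_trans (@sub_suml R R^o _ _ (id_pow 2)).
    by apply: (@spanS R R^o) => z /= zs; rewrite inE zs orbT.
  by apply: (@sub_sumr R R^o); exact: (@submodule_span R R^o).
move=> sub_A; apply: nAx; apply: sub_A.
apply: (@sub_suml R R^o _ _ (id_pow 2)); apply: (@sub_span R R^o).
by rewrite /= mem_head.
Qed.

(** Put [s = l - e]. Strict descent to the nonzero [m^s] gives [rk m^(i+1) >= s - i]; descent from
    [R] through [m] and [m^2] to [m^i] gives [rk m^i <= s - i + 1]. A difference of at most 1 leaves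
    no room for [K]. *)
Lemma ideal_pow_simple_rank i (K : set R) : (2 <= i)%N -> ideal K ->
  pow i.+1 `<` K -> K `<` pow i -> False.
Proof.
move=> i_ge2 idK lt_iK lt_Ki.
have pow_neq0 a b : (a <= b)%N -> pow b <> [set 0] -> pow a <> [set 0].
  move=> le_ab pow_b pow_a; apply: pow_b; apply/seteqP; split.
    by rewrite -pow_a; apply: pow_sub.
  by move=> _ ->; exact: (submodule0 (id_pow b)).
have lower j : (j <= l - e)%N -> (j < rk (pow (l - e - j)))%N.
  elim: j => [_|j IH lt_j].
    rewrite subn0; apply: leq_trans (rk_lt _ _ (_ : [set 0] `<` _)) => //.
      exact: (@submodule_set0 R R^o).
    split=> [_ ->|sub0]; first exact: (submodule0 (id_pow _)).
    apply: stretched_m; apply/seteqP; split=> // _ ->.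
    exact: (submodule0 (id_pow _)).
  apply: leq_ltn_trans (IH (ltnW lt_j)) _.
  have -> : (l - e - j = (l - e - j.+1).+1)%N by lia.
  apply: rk_lt => //; apply: ideal_powS_neq0.
  by apply: pow_neq0 stretched_m; lia.
have upper j : pow (2 + j) <> [set 0] ->
    (rk (pow (2 + j)) + j + 1 + e <= l)%N.
  elim: j => [_|j IH pow_j].
    have : (rk m < rk setT)%N.
      apply: rk_lt => //; first exact: (@submodule_setT R R^o).
      by split=> // /(_ 1 I); apply: maximal_not1 local_m.
    by have := rank_square; have := rk_le setT; rewrite !addn0; lia.
  have pow_j' : pow (2 + j) <> [set 0] by apply: pow_neq0 pow_j; lia.
  have := rk_lt (id_pow _) (id_pow _) (ideal_powS_neq0 pow_j').
  by have := IH pow_j'; rewrite -[(2 + j.+1)%N]/((2 + j).+1); lia.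
have pow_i : pow i <> [set 0].
  move=> pow_i; case: lt_Ki => _; apply; rewrite pow_i => _ ->.
  exact: (submodule0 (idK : @submodule R R^o K)).
have := rk_lt (id_pow _) idK lt_iK; have := rk_lt idK (id_pow _) lt_Ki.
have := upper (i - 2)%N; rewrite subnKC // => /(_ pow_i).
have [lt_i|le_i] := ltnP i (l - e)%N; last by lia.
have := lower (l - e - i.+1)%N; rewrite subKn // => /(_ (leq_subr _ _)); lia.
Qed.

End Rank.

Lemma ideal_pow_simple i (K : set R) : (2 <= i)%N -> ideal K ->
  pow i.+1 `<=` K -> K `<=` pow i -> K `<=` pow i.+1 \/ pow i `<=` K.
Proof.
move=> i_ge2 idK iK Ki.
have [rk [rk_lt rk_le]] := length_rank lenR.
have [|nKi] := pselect (K `<=` pow i.+1); [by left|right].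
apply: contrapT => niK.
exact: (@ideal_pow_simple_rank rk rk_lt rk_le i K).
Qed.

(** If [z] is in [m^2] outside [m^3], then [zR + m^3] is all of [m^2], and Nakayama removes [m^3].
    If there is no such [z], then [m^2 = 0]. *)
Lemma ideal_square_principal : exists2 z, pow 2 z & pow 2 `<=` gen z.
Proof.
have [sub32|/nonsubset[z [pow_z npow_z]]] := pselect (pow 2 `<=` pow 3).
  exists 0; first exact: (submodule0 (id_pow 2)).
  apply: nakayama => //; apply: (subset_trans sub32).
  exact: (@sub_sumr R R^o _ _ (id_gen _)).
exists z => //; apply: nakayama => //.
have [|||//] :=
    ideal_pow_simple (leqnn 2) (id_sum (id_gen z) (id_pow 3)).
- exact: (@sub_sumr R R^o _ _ (id_gen _)).
- apply: (@sum_sub R R^o _ _ _ (id_pow 2)); last exact: pow_sub.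
  exact: (@cyclic_sub R R^o _ _ (id_pow 2)).
move=> sub3; case: npow_z; apply: sub3; apply: (@sub_suml R R^o _ _ (id_pow _)).
exact: (@mem_cyclic R R^o).
Qed.

Lemma maximal_not_principal a : m a -> ~ m `<=` sum (gen a) (pow 2).
Proof.
move=> ma m_sub; have : (e <= size [:: a])%N.
  apply: generating_seq_size => [x|]; first by rewrite inE => /eqP ->.
  apply: (subset_trans m_sub) => x [c ca xc]; exists c => //.
  apply: (@cyclic_sub R R^o a) ca; first exact: (@submodule_span R R^o).
  by apply: (@sub_span R R^o); rewrite /= inE.
by rewrite leqNgt e_ge2.
Qed.

Lemma ideal_mul_image z (J : set R) : ideal J -> ideal [set z * w | w in J].
Proof.
move=> idJ; apply/(@submoduleP R R^o).
split=> [|a _ _ [u Ju <-] [v Jv <-]].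
  by exists 0; rewrite ?mulr0 //; exact: (submodule0 (idJ : @submodule R R^o J)).
exists (a * u + v); last by rewrite mulrDr mulrCA.
apply: (@submoduleD R R^o) => //; exact: idealMl.
Qed.

Lemma exists_square_annihilated :
  exists y, [/\ m y, ~ pow 2 y & forall x, pow 2 x -> x * y = 0].
Proof.
have [z pow_z sub_z] := ideal_square_principal.
have pow3 : pow 3 `<=` [set z * w | w in m].
  apply: ideal_powS_sub => [|a x ma /sub_z[r _ <-]]; first exact: ideal_mul_image.
  exists (r * a); first exact: idealMl.
  by rewrite -[_ *: _]/(r * z) mulrCA [z * a]mulrC mulrCA.
have pow4 : pow 4 `<=` [set z * w | w in pow 2].
  apply: ideal_powS_sub => [|a x ma /pow3[w mw <-]]; first exact: ideal_mul_image.
  exists (a * w); last by rewrite mulrCA.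
  by apply: ideal_pow_mul => //; rewrite (ideal_pow1 id_m).
have m0 : m 0 by exact: (submodule0 (id_m : @submodule R R^o m)).
have [a [ma na]] := (nonsubset (maximal_not_principal m0)).
have npow_a : ~ pow 2 a.
  by move=> pow_a; apply: na; apply: (@sub_sumr R R^o _ _ (id_gen _)).
have [y0 [my0 npow_y0 pow_zy0]] :
    exists y0, [/\ m y0, ~ pow 2 y0 & pow 4 (z * y0)].
  have [pow_za|npow_za] := pselect (pow 4 (z * a)); first by exists a.
  have [b [mb nb]] := (nonsubset (maximal_not_principal ma)).
  have pow_zm x : m x -> pow 3 (z * x).
    by move=> mx; rewrite mulrC; apply: ideal_pow_mul.
  (* If [z a] is outside [m^4], it generates [m^3] modulo [m^4], so [z b] agrees there with some
     [r z a]. As [b] is outside [aR + m^2], [b - r a] is outside [m^2]. *)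
  have [|||sub3] :=
      ideal_pow_simple (leqnSn 2) (id_sum (id_gen (z * a)) (id_pow 4)).
  - exact: (@sub_sumr R R^o _ _ (id_gen _)).
  - apply: (@sum_sub R R^o _ _ _ (id_pow 3)); last exact: pow_sub.
    by apply: (@cyclic_sub R R^o _ _ (id_pow 3)); exact: pow_zm.
  - move=> sub4; case: npow_za; apply: sub4; apply: (@sub_suml R R^o _ _ (id_pow _)).
    exact: (@mem_cyclic R R^o).
  have [_ [r _ <-] pow_d] := sub3 _ (pow_zm b mb).
  exists (b - r * a); split.
  - by apply: (@submoduleB R R^o) => //; exact: idealMl.
  - by move=> pow_d'; apply: nb; exists (r * a) => //; exists r.
  - by rewrite mulrBr mulrCA.
(* Since [m^4] lies in [z m^2], some [w] in [m^2] has [z w = z y0]; then [z], hence [m^2], kills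
   [y0 - w]. *)
have [w pow_w zw] := pow4 _ pow_zy0.
exists (y0 - w); split.
- apply: (@submoduleB R R^o) => //; rewrite -(ideal_pow1 id_m).
  exact: (pow_sub _ pow_w).
- move=> pow_d; apply: npow_y0; rewrite -(subrK w y0).
  exact: (@submoduleD R R^o _ _ _ (id_pow 2) pow_d pow_w).
move=> x /sub_z[r _ <-]; rewrite -[_ *: _]/(r * z) -mulrA mulrBr zw subrr.
by rewrite mulr0.
Qed.

End Stretched.

(** * The subcategory *)

Section NontrivialSubcategory.
Variables (R : comNzRingType) (m : set R) (l e : nat).
Hypotheses (local_m : local_ring m) (lenR : @has_length R R^o l).
Hypotheses (gorR : gorenstein R).
Hypotheses (edim_m : has_edim m e) (e_ge2 : (2 <= e)%N).

Let id_m : ideal m. Proof. by have [_ [+ _ _] _] := local_m. Qed.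

Let unit_or x := local_unit local_m lenR x.

Let socle rho v : rho <> 0 -> (forall x, m x -> x * rho = 0) ->
  (forall x, m x -> x * v = 0) -> exists u, v = u * rho.
Proof. by move=> rho0 m_rho; exact: (gorenstein_socle local_m lenR). Qed.

Let id_pow2 : ideal (ideal_pow m 2) := @ideal_ideal_pow R m 2.

Let mul_square a x : m a -> m x -> ideal_pow m 2 (a * x).
Proof. by move=> ma mx; apply: ideal_pow_mul => //; rewrite (ideal_pow1 id_m). Qed.

(** Otherwise the socle would be [yR]. A nonzero element of [m^2] would have a nonzero multiple in
    the socle, putting [y] in [m^2]; so [m^2 = 0], [m] is the socle, and [m = yR] contradicts
    [e >= 2]. *)
Lemma not_socle y : m y -> ~ ideal_pow m 2 y ->
  exists2 x, m x & x * y <> 0.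
Proof.
move=> my npow_y; apply: contrapT => /forall2NP h.
have m_y x : m x -> x * y = 0.
  by move=> mx; have [//|/contrapT] := h x.
have y0 : y <> 0.
  by move=> y0; apply: npow_y; rewrite y0; exact: (submodule0 id_pow2).
have pow2_0 x : ideal_pow m 2 x -> x = 0.
  move=> pow_x; apply: contrapT => x0.
  pose J : set R := [set a | a * x = 0].
  have idJ : ideal J.
    apply/(@submoduleP R R^o); split=> [|a u v]; rewrite /J /= ?mul0r //.
    by move=> ux vx; rewrite mulrDl -[_ *: _]/(a * u) -mulrA ux vx mulr0 addr0.
  have nJT : J <> setT.
    by move=> JT; apply: x0; rewrite -[x]mul1r; have : J 1 by rewrite JT.
  have [a nJa mJa] := exists_simple_extension local_m lenR idJ nJT.
  have [c mc|u def_ax] := @socle y (a * x) y0 m_y.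
    by rewrite mulrA; exact: mJa.
  have [mu|[z zu]] := unit_or u; first by apply: nJa; rewrite /J /= def_ax m_y.
  apply: npow_y; rewrite -[y]mul1r -zu -mulrA -def_ax mulrA.
  exact: idealMl id_pow2 pow_x.
apply: (maximal_not_principal local_m lenR edim_m e_ge2 my) => x mx.
have [c mc|u ->] := @socle y x y0 m_y; first by apply: pow2_0; apply: mul_square.
by apply: (@sub_suml R R^o _ _ id_pow2); exists u.
Qed.

Section Pair.
Variables (y b : R).
Hypotheses (my : m y) (npow_y : ~ ideal_pow m 2 y).
Hypothesis square_y : forall x, ideal_pow m 2 x -> x * y = 0.
Hypotheses (mb : m b) (by0 : b * y <> 0) (nby : ~ @cyclic R R^o y b).

Let socle_my c : m c -> forall x, m x -> x * (c * y) = 0.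
Proof. by move=> mc x mx; rewrite mulrA square_y //; apply: mul_square. Qed.

(** The socle is generated by [b y] and contains [b t], so [b t = c b y] and [b] kills
    [d = t - c y]. For [x] in [m], [x y = u b y] makes [x - u b] kill [y], hence [d], so [x d = 0].
    Thus [d] is in the socle, inside [yR]. *)
Lemma double_annihilator t : (forall a, a * y = 0 -> a * t = 0) ->
  exists c, t = c * y.
Proof.
move=> ann_t.
have [x mx|c def_bt] := @socle (b * y) (b * t) by0 (socle_my mb).
  by rewrite mulrA; apply: ann_t; apply: square_y; apply: mul_square.
have [x mx|u def_d] := @socle (b * y) (t - c * y) by0 (socle_my mb).
  have [|u def_xy] := @socle (b * y) (x * y) by0 (socle_my mb).
    exact: socle_my.
  have ann_xub : (x - u * b) * y = 0.
    by rewrite mulrBl def_xy mulrA subrr.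
  rewrite -[x](subrK (u * b)) mulrDl mulrBr ann_t // [_ * (c * y)]mulrCA ann_xub.
  rewrite mulr0 subrr add0r -mulrA mulrBr def_bt [b * (c * y)]mulrCA subrr.
  by rewrite mulr0.
by exists (u * b + c); rewrite mulrDl -mulrA -def_d subrK.
Qed.

(** Here [w = r b = c y]. A unit [c] would put [y] in [m^2] if [r] is in [m], and [b] in [yR] if [r]
    is a unit. So [c] is in [m], and the socle element [c y] equals [u b y], which is [y] times
    [u b] in [bR]. *)
Lemma Ext1_vanishes_cyclic :
  Ext1_vanishes y (submodule_type (@submodule_cyclic R R^o b)).
Proof.
move=> w kill_w; have [r _ def_w] := submodule_typeP w.
have [a ay0|c def_w'] := @double_annihilator (val w).
  by have /(congr1 val) := kill_w a ay0.
have mc : m c.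
  have [//|[z zc]] := unit_or c; exfalso.
  have def_y : y = z * (r * b).
    by rewrite -[r * b]/(r *: (b : R^o)) def_w def_w' mulrA zc mul1r.
  have [mr|[s sr]] := unit_or r.
    by apply: npow_y; rewrite def_y; apply: (idealMl _ id_pow2); apply: mul_square.
  apply: nby; exists (s * c) => //.
  rewrite -[LHS]/(s * c * y) -mulrA -def_w' -def_w -[_ *: _]/(r * b).
  by rewrite mulrA sr mul1r.
have [|u def_cy] := @socle (b * y) (c * y) by0 (socle_my mb).
  exact: socle_my.
have ub : @cyclic R R^o b (u * b) by exists u.
exists (insub_submodule (submodule_cyclic _) ub); apply/val_inj.
by rewrite def_w' def_cy mulrA mulrC.
Qed.

Lemma fg_Ext1_vanishes_cyclic :
  fg_Ext1_vanishes y (submodule_type (@submodule_cyclic R R^o b)).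
Proof. by split; [apply: finitely_generated_cyclic|apply: Ext1_vanishes_cyclic]. Qed.

(** The annihilator of [y] lies in [m] and so kills [b y], but [y] itself kills the socle, so [b y]
    is not [y] times a socle element. *)
Lemma not_Ext1_vanishes_socle :
  ~ Ext1_vanishes y (submodule_type (@submodule_cyclic R R^o (b * y))).
Proof.
have y0 : y <> 0 by move=> y0; apply: by0; rewrite y0 mulr0.
have gen_by := @mem_cyclic R R^o (b * y).
pose w := insub_submodule (@submodule_cyclic R R^o (b * y)) gen_by.
case/(_ w) => [a ay0|v /(congr1 val) /= def_by].
  apply/val_inj; have [ma|[z za]] := unit_or a; first exact: socle_my ma.
  by case: y0; rewrite -[y]mul1r -za -mulrA ay0 mulr0.
have [r _ def_v] := submodule_typeP v.
apply: by0; rewrite def_by -def_v -[_ *: (r *: _)]/(y * (r * (b * y))).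
by rewrite mulrCA socle_my // mulr0.
Qed.

(** The nonzero element [b y] kills the nonzero module [bR], but no free module of positive rank. *)
Lemma cyclic_not_free :
  ~ is_fg_free (submodule_type (@submodule_cyclic R R^o b)).
Proof.
have gen_b := @mem_cyclic R R^o b.
pose w := insub_submodule (@submodule_cyclic R R^o b) gen_b.
have w0 : w <> 0.
  by move=> /(congr1 val) /= b0; apply: by0; rewrite [b]b0 mul0r.
have kill v : (b * y) *: v = 0 :> submodule_type (@submodule_cyclic R R^o b).
  apply/val_inj; have [r _ def_v] := submodule_typeP v.
  transitivity (b * y * (r * b)).
    by rewrite -[r * b]/(r *: (b : R^o)) def_v.
  by rewrite mulrCA [_ * b]mulrC socle_my // mulr0.
case=> -[|n] [f [g fK gK]].
  by apply: w0; rewrite -[w]gK [g w]thinmx0 linear0.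
apply: by0; have : f ((b * y) *: const_mx 1) = f 0.
  by rewrite linearZ /= kill linear0.
move=> /(can_inj fK)/rowP/(_ ord0); by rewrite !mxE mulr1.
Qed.

Lemma nontrivial_fg_Ext1_vanishes :
  ~ trivial_subcategory (@fg_Ext1_vanishes R y).
Proof.
case=> [zeroP|freeP|fgP].
- have gen_b := @mem_cyclic R R^o b.
  have /(congr1 val) /= b0 := (zeroP _).1 fg_Ext1_vanishes_cyclic
    (insub_submodule (@submodule_cyclic R R^o b) gen_b).
  by apply: by0; rewrite [b]b0 mul0r.
- exact: cyclic_not_free ((freeP _).1 fg_Ext1_vanishes_cyclic).
have [_] := (fgP _).2 (@finitely_generated_cyclic R R^o (b * y)).
exact: not_Ext1_vanishes_socle.
Qed.

End Pair.

Lemma exists_nontrivial_pair y : m y -> ~ ideal_pow m 2 y ->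
  exists b, [/\ m b, b * y <> 0 & ~ @cyclic R R^o y b].
Proof.
move=> my npow_y.
have [x mx xy0] := not_socle my npow_y.
have [z [mz nz]] := nonsubset (maximal_not_principal local_m lenR edim_m e_ge2 my).
have nzy : ~ @cyclic R R^o y z.
  by move=> yz; apply: nz; apply: (@sub_suml R R^o _ _ id_pow2).
have [yx|nyx] := pselect (@cyclic R R^o y x); last by exists x.
have [zy0|zy0] := pselect (z * y = 0); last by exists z.
(* Here [x] is in [yR] but does not kill [y], while [z] kills [y] but is outside [yR]; the sum
   avoids both. *)
exists (z + x); split; first exact: (@submoduleD R R^o _ _ _ id_m).
  by rewrite mulrDl zy0 add0r.
move=> yzx; apply: nzy; rewrite -(addrK x z).
exact: (submoduleB (@submodule_cyclic R R^o y) yzx yx).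
Qed.

End NontrivialSubcategory.

Local Close Scope ring_scope.

Theorem corollary2p8 (R : comNzRingType) (m : set R) (e : nat)
    (Rlocal : local_ring m) (Rart : artinian R) (Rgor : gorenstein R)
    (Rstr : stretched m) (Redim : has_edim m e) (e_ge2 : 2 <= e) :
  exists P : lmodType R -> Prop, extension_closed P /\ ~ trivial_subcategory P.
Proof.
have [l [e' [lenR edim_e' stretched_m]]] := Rstr.
(* The [e'] provided by stretchedness is at least [e], because [e'] elements generate [m]. *)
have e'_ge2 : (2 <= e')%N by apply: leq_trans e_ge2 _; apply: Redim.2 edim_e'.1.
have [y [my npow_y square_y]] :=
  exists_square_annihilated Rlocal lenR edim_e' e'_ge2 stretched_m.
have [b [mb by0 nby]] :=
  exists_nontrivial_pair Rlocal lenR Rgor edim_e' e'_ge2 my npow_y.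
exists (@fg_Ext1_vanishes R y); split; last first.
  exact: (nontrivial_fg_Ext1_vanishes Rlocal lenR Rgor my npow_y square_y
            mb by0 nby).
apply: extension_closed_fg_Ext1_vanishes.
exact: (fg_Ext1_vanishes_cyclic Rlocal lenR Rgor npow_y square_y mb by0 nby).
Qed.
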